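(* Let $\mathbb Z^{(mix)}[h_r\mid r>0]$ be the $\mathbb Z$-subalgebra of $\mathbb Q[h_r\mid r>0]$ generated by $\{\hat h_k,\bar h_k\mid k>0\}$. Then $\mathbb Z^{(mix)}[h_r\mid r>0]$ is a free $\mathbb Z[\bar h_{2r}\mid r>0]$-module with basis $$\Big\{\prod_{k>0}\hat h_k^{\epsilon_k}\ \Big|\ \epsilon:\mathbb Z_{>0}\to\{0,1\}\text{ finitely supported}\Big\}.$$ Equivalently, $$B_{q.pol}=\Big\{\prod_{k>0}\hat h_k^{\epsilon_k}\prod_{k>0}\bar h_{2k}^{d_k}\ \Big|\ \epsilon:\mathbb Z_{>0}\to\{0,1\},\ d:\mathbb Z_{>0}\to\mathbb N\text{ finitely supported}\Big\}$$ is a $\mathbb Z$-basis of $\mathbb Z^{(mix)}[h_r\mid r>0]$.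
   Context: $\mathbb Q[h_r\mid r\in\mathbb Z_{>0}]$ is the polynomial algebra in the variables $h_r$. For $a:\mathbb Z_{>0}\to\mathbb Q$ define $\hat h_k^{\{a\}}$ by $\sum_{k\ge0}\hat h_k^{\{a\}}u^k=\exp\left(\sum_{r>0}(-1)^{r-1}\frac{a_rh_r}{r}u^r\right)$. Then $\hat h_k=\hat h_k^{\{a\}}$ for $a_r=1$ for all $r$, and $\bar h_k=\hat h_k^{\{a\}}$ for $a_r=1$ if $r$ is even and $a_r=0$ if $r$ is odd (so $\bar h_k=0$ for $k$ odd). $\mathbb Z[\bar h_{2r}\mid r>0]$ denotes the $\mathbb Z$-subalgebra generated by the $\bar h_{2r}$. *)

(* Defs.v *)
From HB Require Import structures.
From mathcomp Require Import all_boot all_order all_algebra.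
From mathcomp Require Import finmap.
From mathcomp Require Import monalg.

Set Implicit Arguments.
Unset Strict Implicit.
Unset Printing Implicit Defensive.

Import GRing.Theory.

Local Open Scope ring_scope.

Definition posnat := {r : nat | (0 < r)%N}.
HB.instance Definition _ := Choice.on posnat.

Definition posS (n : nat) : posnat := exist _ n.+1 (ltn0Sn n).

(* Q[h_r | r > 0]: the Q-algebra on the free commutative monoid over posnat. *)
Definition Qh := {malg rat[{cmonom posnat}]}.
HB.instance Definition _ := GRing.ComAlgebra.on Qh.

Definition h (r : posnat) : Qh := mkmalgU (ucm r) 1.

Section FormalPowerSeries.
Variable A : comAlgType rat.

(* A formal power series \sum_n (f n) u^n over A is its coefficient sequence. *)
Definition fps := nat -> A.

Definition fps_one : fps := fun n => (n == 0%N)%:R.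

Definition fps_mul (f g : fps) : fps :=
  fun n => \sum_(i < n.+1) f i * g (n - i)%N.

Definition fps_pow (f : fps) (m : nat) : fps := iter m (fps_mul f) fps_one.

(* exp f = \sum_m f^m / m!, for f without constant term; then f^m has no
   coefficient below u^m (fps_pow_small), so m <= n suffices at u^n. *)
Definition fps_exp (f : fps) : fps :=
  fun n => \sum_(m < n.+1) (m`!%:R^-1 : rat) *: fps_pow f m n.

Lemma fps_pow_small (f : fps) (m n : nat) :
  f 0%N = 0 -> (n < m)%N -> fps_pow f m n = 0.
Proof.
move=> f0; elim: m n => [|m IHm] n //= lt_nm.
rewrite /fps_mul big1 // => -[[|i] /= le_in] _; first by rewrite f0 mul0r.
rewrite [fps_pow f m _]IHm ?mulr0 //.
by case: n le_in lt_nm => [|n] // _; rewrite subSS => /(leq_ltn_trans (leq_subr i n)).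
Qed.

End FormalPowerSeries.

(* \sum_(r > 0) (-1)^(r-1) (a_r h_r / r) u^r *)
Definition hlog (a : posnat -> rat) : fps Qh :=
  fun r => if r is n.+1
           then ((-1) ^+ n * (a (posS n) / n.+1%:R)) *: h (posS n)
           else 0.

Definition hatha (a : posnat -> rat) (k : nat) : Qh := fps_exp (hlog a) k.

Definition hath (k : nat) : Qh := hatha (fun=> 1) k.

Definition barh (k : nat) : Qh := hatha (fun r => (~~ odd (val r))%:R) k.

Inductive Zalg_gen (A : nzRingType) (S : A -> Prop) : A -> Prop :=
| Zalg_gen_in x : S x -> Zalg_gen S x
| Zalg_gen_1 : Zalg_gen S 1
| Zalg_gen_sub x y : Zalg_gen S x -> Zalg_gen S y -> Zalg_gen S (x - y)
| Zalg_gen_mul x y : Zalg_gen S x -> Zalg_gen S y -> Zalg_gen S (x * y).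

Definition Zmix : Qh -> Prop :=
  Zalg_gen (fun x => exists k : posnat, x = hath (val k) \/ x = barh (val k)).

Definition Zbar : Qh -> Prop :=
  Zalg_gen (fun x => exists r : posnat, x = barh (2 * val r)).

(* The family b is a basis of M as a module over the scalars s : C satisfying K,
   which act on V by act. Subrings are Prop-valued, so K and M are predicates
   on ambient types; linear combinations have finitely supported coefficients. *)
Record free_module_basis (C V : zmodType) (act : C -> V -> V)
    (K : C -> Prop) (M : V -> Prop) (I : choiceType) (b : I -> V) : Prop :=
  FreeModuleBasis {
    fmb_zero : M 0;
    fmb_sub : forall x y, M x -> M y -> M (x - y);
    fmb_act : forall s x, K s -> M x -> M (act s x);
    fmb_mem : forall i, M (b i);
    fmb_span : forall x, M x ->
      exists c : {fsfun I -> C with 0},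
        (forall i, K (c i)) /\ x = \sum_(i <- finsupp c) act (c i) (b i);
    fmb_free : forall c : {fsfun I -> C with 0},
      (forall i, K (c i)) -> \sum_(i <- finsupp c) act (c i) (b i) = 0 ->
      forall i, c i = 0
  }.

Definition hat_prod (eps : {fsfun posnat -> bool with false}) : Qh :=
  \prod_(k <- finsupp eps) hath (val k) ^+ eps k.

Definition bar_prod (d : {fsfun posnat -> nat with 0%N}) : Qh :=
  \prod_(k <- finsupp d) barh (2 * val k) ^+ d k.

Definition Bqpol
    (p : {fsfun posnat -> bool with false} * {fsfun posnat -> nat with 0%N}) :
    Qh :=
  hat_prod p.1 * bar_prod p.2.

(* Main.v *)
(* Write E(u) and B(u) for the generating series of the hath k and barh k. Since
   log B is the even part of log E, E(u) E(-u) = B(u)^2; the coefficient of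
   u^(2k) expresses (hath k)^2 through products of strictly more spread out
   indices and elements of Zbar, which gives spanning.
   For independence, the h r are free, so there is a ring endomorphism phi of Qh
   sending hath n to 2 h_n for n odd and barh n to 4 h_n for n > 0 even. The same
   relation then shows that phi (hath n) / 2 is an integral polynomial, congruent
   modulo 2 to h_m^(2^a), where n = 2^a m with m odd. Hence, up to a power of 2,
   the image of each element of Bqpol is congruent modulo 2 to a monomial, and by
   uniqueness of binary expansions these monomials are distinct: the coefficients
   of a linear relation are divisible by every power of 2. *)
Require Import Defs.
From HB Require Import structures.
From mathcomp Require Import all_boot all_order all_algebra.
From mathcomp Require Import finmap.
From mathcomp Require Import monalg.
From mathcomp Require Import ring zify.

Import GRing.Theory.
Local Open Scope ring_scope.

Set Implicit Arguments.
Unset Strict Implicit.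
Unset Printing Implicit Defensive.

(** * Exponentials of formal power series *)

Section PowerSeries.
Variable A : comAlgType rat.
Implicit Types f g : fps A.

(** Differentiation multiplies the coefficient of u^(n+1) by [n.+1]; over the rationals this factor
    cancels. *)
Lemma mulrSnI n : injective (fun x : A => x *+ n.+1).
Proof.
move=> x y /= exy; have n0 : (n.+1%:R : rat) != 0 by rewrite Num.Theory.pnatr_eq0.
by rewrite -[x](scalerK n0) -[y](scalerK n0) !scaler_nat exy.
Qed.

(** The coefficient of u^n in a Cauchy product involves only coefficients up to n, so truncations
    carry the ring laws and the Leibniz rule of [{poly A}] over to series. *)
Definition fps_trunc (N : nat) f : {poly A} := \poly_(i < N.+1) f i.

Lemma coef_fps_trunc N f n : (n <= N)%N -> (fps_trunc N f)`_n = f n.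
Proof. by rewrite coef_poly ltnS => ->. Qed.

Lemma fps_mul_trunc N f g n :
  (n <= N)%N -> fps_mul f g n = (fps_trunc N f * fps_trunc N g)`_n.
Proof.
move=> le_nN; rewrite coefM; apply: eq_bigr => i _.
rewrite !coef_fps_trunc ?(leq_trans (leq_subr _ _)) //.
by rewrite (leq_trans _ le_nN) // -ltnS.
Qed.

Lemma fps_mulC f g n : fps_mul f g n = fps_mul g f n.
Proof. by rewrite !(fps_mul_trunc _ _ (leqnn n)) mulrC. Qed.

Lemma eq_fps_mul_le f f' g g' n :
    (forall i, (i <= n)%N -> f i = f' i) ->
    (forall i, (i <= n)%N -> g i = g' i) ->
  fps_mul f g n = fps_mul f' g' n.
Proof.
by move=> ef eg; apply: eq_bigr => i _; rewrite ef ?eg ?leq_subr // -ltnS.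
Qed.

Lemma fps_mulA f g k n :
  fps_mul f (fps_mul g k) n = fps_mul (fps_mul f g) k n.
Proof.
have truncM u v : forall i, (i <= n)%N ->
    fps_mul u v i = (fps_trunc n u * fps_trunc n v)`_i.
  by move=> i; apply: fps_mul_trunc.
have -> : fps_mul f (fps_mul g k) n
    = (fps_trunc n f * (fps_trunc n g * fps_trunc n k))`_n.
  rewrite coefM; apply: eq_bigr => i _.
  by rewrite truncM ?leq_subr // coef_fps_trunc // -ltnS.
rewrite mulrA coefM; apply: eq_bigr => i _.
rewrite truncM; last by rewrite -ltnS.
by rewrite coef_fps_trunc ?leq_subr.
Qed.

Definition fps_der f : fps A := fun n => f n.+1 *+ n.+1.

Lemma fps_derM f g n :
  fps_der (fps_mul f g) n
    = fps_mul (fps_der f) g n + fps_mul f (fps_der g) n.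
Proof.
rewrite /fps_der (fps_mul_trunc _ _ (leqnn _)) -coef_deriv derivM coefD !coefM.
have lt i : (i < n.+1)%N -> (n - i <= n.+1)%N.
  by move=> _; rewrite (leq_trans (leq_subr _ _)).
congr (_ + _); apply: eq_bigr => i _.
  by rewrite coef_deriv !coef_fps_trunc ?lt.
rewrite coef_deriv !coef_fps_trunc //; last exact: ltnW.
by rewrite ltnS leq_subr.
Qed.

Lemma fps_der_pow f m n :
  fps_der (fps_pow f m.+1) n = fps_mul (fps_der f) (fps_pow f m) n *+ m.+1.
Proof.
elim: m n => [|m IHm] n.
  rewrite /= fps_derM [X in _ + X]big1 ?addr0 ?mulr1n // => i _.
  by rewrite /fps_der /fps_one mul0rn mulr0.
rewrite [fps_pow f m.+2]/= fps_derM [RHS]mulrS; congr (_ + _).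
transitivity (fps_mul f (fun i => fps_mul (fps_der f) (fps_pow f m) i *+ m.+1) n).
  exact: eq_fps_mul_le.
transitivity (fps_mul f (fps_mul (fps_der f) (fps_pow f m)) n *+ m.+1).
  by rewrite -[RHS]sumrMnl; apply: eq_bigr => i _; rewrite mulrnAr.
rewrite fps_mulA; congr (_ *+ _).
rewrite (@eq_fps_mul_le _ (fps_mul (fps_der f) f) _ (fps_pow f m)) //.
  by rewrite -fps_mulA.
by move=> i _; apply: fps_mulC.
Qed.

Lemma fps_exp0 f : fps_exp f 0 = 1.
Proof. by rewrite /fps_exp big_ord1 /= /fps_one fact0 invr1 scale1r. Qed.

Lemma fps_exp_widen f N n : f 0%N = 0 -> (n <= N)%N ->
  fps_exp f n = \sum_(m < N.+1) (m`!%:R^-1 : rat) *: fps_pow f m n.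
Proof.
move=> f0 le_nN; rewrite /fps_exp.
rewrite (big_ord_widen N.+1 (fun m => (m`!%:R^-1 : rat) *: fps_pow f m n)
  (le_nN : n.+1 <= N.+1)%N).
rewrite big_mkcond /=; apply: eq_bigr => m _; case: ltnP => // lt_nm.
by rewrite fps_pow_small ?scaler0.
Qed.

(** The derivative of f^m/m! is f' f^(m-1)/(m-1)!: the term m = 0 disappears and the others
    reassemble into f' exp f. *)
Lemma fps_der_exp f n : f 0%N = 0 ->
  fps_der (fps_exp f) n = fps_mul (fps_der f) (fps_exp f) n.
Proof.
move=> f0; rewrite /fps_der /fps_exp -sumrMnl big_ord_recl /=.
rewrite /fps_one scaler0 mul0rn add0r.
transitivity (\sum_(m < n.+1)
    (m`!%:R^-1 : rat) *: fps_mul (fps_der f) (fps_pow f m) n).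
  apply: eq_bigr => m _; rewrite /bump leq0n add1n scalerMnr.
  rewrite -[X in _ *: X]/(fps_der (fps_pow f m.+1) n) fps_der_pow.
  rewrite -scaler_nat scalerA factS natrM invfM -mulrA.
  by rewrite mulrCA mulVf ?mulr1 // Num.Theory.pnatr_eq0.
under eq_bigr do rewrite /fps_mul scaler_sumr.
rewrite exchange_big; apply: eq_bigr => i _ /=.
rewrite -[RHS]/(fps_der f i * fps_exp f (n - i)%N).
(* The exponential at [n - i] is summed up to the common bound [n]; the added terms vanish. *)
rewrite (fps_exp_widen f0 (leq_subr i n)) mulr_sumr.
by apply: eq_bigr => m _; rewrite scalerAr.
Qed.

(** The equation g' = f' g gives (n+1) g_(n+1) in terms of g_0, ..., g_n. Both [fps_expD] and
    [fps_exp_alt] are proved by checking this equation. *)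
Lemma fps_exp_unique f g : f 0%N = 0 -> g 0%N = 1 ->
  (forall n, fps_der g n = fps_mul (fps_der f) g n) -> g =1 fps_exp f.
Proof.
move=> f0 g0 dg; elim/ltn_ind=> -[_|n IHn]; first by rewrite g0 fps_exp0.
apply: (@mulrSnI n); rewrite -/(fps_der g n) dg.
rewrite -/(fps_der (fps_exp f) n) fps_der_exp //.
by apply: eq_fps_mul_le => // i le_in; apply: IHn.
Qed.

Lemma eq_fps_exp_le f g n : (forall i, (i <= n)%N -> f i = g i) ->
  fps_exp f n = fps_exp g n.
Proof.
move=> efg; apply: eq_bigr => m _; congr (_ *: _).
suff: forall i, (i <= n)%N -> fps_pow f m i = fps_pow g m i by apply.
elim: (nat_of_ord m) => //= k IHk i le_in.
by apply: eq_fps_mul_le => j le_ji; rewrite ?IHk ?efg // (leq_trans le_ji).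
Qed.

Lemma eq_fps_exp f g : f =1 g -> fps_exp f =1 fps_exp g.
Proof. by move=> efg n; apply: eq_fps_exp_le. Qed.

Lemma fps_expS f n : f 0%N = 0 ->
  fps_exp f n.+1 *+ n.+1
    = \sum_(i < n) fps_der f i * fps_exp f (n - i)%N + f n.+1 *+ n.+1.
Proof.
move=> f0; rewrite -/(fps_der _ _) fps_der_exp // /fps_mul big_ord_recr /=.
by rewrite subnn fps_exp0 mulr1.
Qed.

(** In the recursion [fps_expS], [f n.+1] occurs once, linearly, with the same factor [n.+1] as the
    left-hand side. Hence a prescribed coefficient of the exponential can be solved for [f n.+1]. *)
Lemma fps_exp_top f g n : f 0%N = 0 -> g 0%N = 0 ->
    (forall i, (i <= n)%N -> f i = g i) ->
  fps_exp f n.+1 = fps_exp g n.+1 + (f n.+1 - g n.+1).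
Proof.
move=> f0 g0 efg; apply: (@mulrSnI n); rewrite mulrnDl mulrnBl !fps_expS //.
rewrite -addrA; congr (_ + _); last by rewrite addrC subrK.
apply: eq_bigr => i _; rewrite /fps_der efg //; congr (_ * _).
apply: eq_fps_exp_le => j le_j; apply: efg.
exact: leq_trans le_j (leq_subr _ _).
Qed.

Lemma fps_expD f g n : f 0%N = 0 -> g 0%N = 0 ->
  fps_mul (fps_exp f) (fps_exp g) n = fps_exp (fun i => f i + g i) n.
Proof.
move=> f0 g0; apply: (fps_exp_unique (f := fun i => f i + g i)) n => [||n].
- by rewrite f0 g0 addr0.
- by rewrite /fps_mul big_ord1 !fps_exp0 mulr1.
rewrite fps_derM.
transitivity (fps_mul (fps_der f) (fps_mul (fps_exp f) (fps_exp g)) n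
            + fps_mul (fps_der g) (fps_mul (fps_exp f) (fps_exp g)) n).
  congr (_ + _).
    by rewrite fps_mulA; apply: eq_fps_mul_le => // i _; rewrite fps_der_exp.
  rewrite [RHS](@eq_fps_mul_le _ (fps_der g) _ (fps_mul (fps_exp g) (fps_exp f))) //.
    rewrite fps_mulA fps_mulC; apply: eq_fps_mul_le => // i _.
    by rewrite fps_der_exp.
  by move=> i _; rewrite fps_mulC.
rewrite -big_split; apply: eq_bigr => i _ /=.
by rewrite -mulrDl /fps_der mulrnDl.
Qed.

(** * Even parts and the reflection u -> -u *)

Definition fps_alt f : fps A := fun n => (-1) ^+ n * f n.

Definition fps_even f : fps A := fun n => if odd n then 0 else f n.

Lemma fps_exp_alt f n : f 0%N = 0 -> fps_exp (fps_alt f) n = fps_alt (fps_exp f) n.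
Proof.
move=> f0; apply/esym; apply: (fps_exp_unique (f := fps_alt f)) n => [||n].
- by rewrite /fps_alt f0 mulr0.
- by rewrite /fps_alt fps_exp0 mulr1.
rewrite /fps_der /fps_alt -mulrnAr -/(fps_der _ n) fps_der_exp // mulr_sumr.
apply: eq_bigr => i _; rewrite /fps_der -mulrnAr mulrACA; congr (_ * _).
by rewrite -exprD addSn subnKC // -ltnS.
Qed.

(** The even part is fixed by u -> -u, hence so is its exponential, and each odd coefficient equals
    its own negative. *)
Lemma fps_exp_even_odd f n : f 0%N = 0 -> odd n -> fps_exp (fps_even f) n = 0.
Proof.
move=> f0 odd_n; have /(_ n) : fps_exp (fps_alt (fps_even f)) =1 fps_exp (fps_even f).
  apply: eq_fps_exp => i; rewrite /fps_alt /fps_even; case: ifPn => [_|ev_i].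
    by rewrite mulr0.
  by rewrite -signr_odd (negPf ev_i) mul1r.
rewrite fps_exp_alt // /fps_alt -signr_odd odd_n mulN1r => exN.
by apply: (@mulrSnI 1); rewrite mulr2n mul0rn -{1}exN addNr.
Qed.

(** Both sides are the exponential of f(u) + f(-u), which is twice the even part of f. *)
Lemma fps_exp_reflect f n : f 0%N = 0 ->
  fps_mul (fps_exp f) (fps_alt (fps_exp f)) n
    = fps_mul (fps_exp (fps_even f)) (fps_exp (fps_even f)) n.
Proof.
move=> f0; rewrite fps_expD // -(@eq_fps_mul_le (fps_exp f) _ (fps_exp (fps_alt f))) //.
  rewrite fps_expD // ?/fps_alt ?f0 ?mulr0 //; apply: eq_fps_exp => i.
  rewrite /fps_even -signr_odd; case: ifP => _; last by rewrite mul1r.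
  by rewrite mulN1r subrr addr0.
by move=> i _; rewrite fps_exp_alt.
Qed.

(** Folding the sum about its middle index leaves the term [s k] alone; this isolates the square in
    a coefficient of even degree. *)
Lemma sum_sym_double (s : nat -> A) k :
    (forall i, (i <= k.*2)%N -> s (k.*2 - i)%N = s i) ->
  \sum_(i < k.*2.+1) s i = s k + (\sum_(i < k) s i) *+ 2.
Proof.
move=> sym; rewrite -(big_mkord xpredT) (@big_cat_nat _ _ _ k.+1) //=; last first.
  by rewrite ltnS -addnn leq_addr.
rewrite big_nat_recr //= big_mkord mulr2n [s k + _]addrCA addrA; congr (_ + _).
have -> : k.*2.+1 = (k + k.+1)%N by rewrite addnS addnn.
rewrite -{1}[k.+1]add0n big_addn addnK big_mkord.
rewrite (reindex_inj rev_ord_inj) /=; apply: eq_bigr => i _.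
rewrite -[RHS]sym; last by rewrite -addnn (leq_trans (ltnW (ltn_ord i))) // leq_addr.
congr s; rewrite -addnn addnS -addSn subnSK //.
by rewrite addnC addnBA // ltnW.
Qed.

(* The coefficient of u^(2k) in E(u) E(-u) = B(u)^2, E = exp f, B = exp (even f). *)
Lemma fps_exp_reflect_double f k : f 0%N = 0 ->
  let e := fps_exp f in let b := fps_exp (fps_even f) in
  (-1) ^+ k * (e k * e k) + (\sum_(i < k) (-1) ^+ i * (e i * e (k.*2 - i)%N)) *+ 2
    = b k * b k + (\sum_(i < k) b i * b (k.*2 - i)%N) *+ 2.
Proof.
move=> f0 e b; have := fps_exp_reflect k.*2 f0; rewrite -/e -/b /fps_mul.
rewrite (@sum_sym_double (fun i => e i * fps_alt e (k.*2 - i)%N)); last first.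
  move=> i le_i; rewrite /fps_alt subKn // mulrCA [RHS]mulrCA [e i * _]mulrC.
  by rewrite -[in RHS]signr_odd oddB // odd_double signr_odd.
rewrite (@sum_sym_double (fun i => b i * b (k.*2 - i)%N)); last first.
  by move=> i le_i; rewrite subKn // mulrC.
have k2 : (k.*2 - k)%N = k by rewrite -addnn addnK.
rewrite !k2 /fps_alt mulrCA => <-; congr (_ + _ *+ 2).
apply: eq_bigr => i _; rewrite [RHS]mulrCA; congr (_ * _).
rewrite -[RHS]signr_odd oddB ?odd_double ?signr_odd //.
by rewrite -addnn (leq_trans (ltnW (ltn_ord i))) // leq_addr.
Qed.

(** The term i = 0 is split off: since both constant terms are 1, it is the bare top coefficient
    [e n] or [b n]. *)
Lemma fps_exp_reflect_doubleS f k : f 0%N = 0 ->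
  let e := fps_exp f in let b := fps_exp (fps_even f) in let n := k.+1.*2 in
  (-1) ^+ k.+1 * (e k.+1 * e k.+1)
      + (e n + \sum_(i < k) (-1) ^+ i.+1 * (e i.+1 * e (n - i.+1)%N)) *+ 2
    = b k.+1 * b k.+1 + (b n + \sum_(i < k) b i.+1 * b (n - i.+1)%N) *+ 2.
Proof.
move=> f0 e b n; have := fps_exp_reflect_double k.+1 f0.
rewrite /= -/e -/b !big_ord_recl /= -/n subn0 [e 0%N]fps_exp0 [b 0%N]fps_exp0.
by rewrite expr0 !mul1r.
Qed.

(** * Logarithms with prescribed coefficients of the exponential *)

Section Prescribed.
Variable t : nat -> A.

(** Stage [N] sets only the coefficient of u^N, to the defect from [t N]: the defect of the whole
    exponential for odd [N], and of the exponential of the even part for even [N]. *)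
Fixpoint log_approx (N : nat) : fps A :=
  if N is n.+1 then fun r =>
    if r == N
    then t N - fps_exp (if odd N then log_approx n else fps_even (log_approx n)) N
    else log_approx n r
  else fun=> 0.

Lemma log_approx_gt N r : (N < r)%N -> log_approx N r = 0.
Proof.
elim: N => //= N IHN lt_r; rewrite gtn_eqF // IHN //.
exact: ltnW.
Qed.

Lemma log_approx_stable N r : (r <= N)%N -> log_approx N r = log_approx r r.
Proof.
elim: N => [|N IHN]; first by rewrite leqn0 => /eqP->.
by rewrite leq_eqVlt => /predU1P[->//|lt_r]; rewrite /= ltn_eqF // IHN.
Qed.

Lemma fps_exp_prescribed : exists f : fps A, [/\ f 0%N = 0,
  forall n, odd n -> fps_exp f n = t n &
  forall n, ~~ odd n -> (0 < n)%N -> fps_exp (fps_even f) n = t n].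
Proof.
(* Coefficient [r] is final from stage [r] on, so the diagonal collects all stages. *)
pose f r := log_approx r r; exists f.
have f0 : f 0%N = 0 by [].
have approx0 n : log_approx n 0 = 0 by rewrite log_approx_stable.
have stable n i : (i <= n)%N -> f i = log_approx n i.
  by move=> le_i; rewrite log_approx_stable.
split=> // -[//|n] odd_n; last move=> _.
  (* [log_approx n] vanishes at [n.+1], so the coefficient added there corrects the exponential to
     exactly [t n.+1]. *)
  rewrite (fps_exp_top (g := log_approx n)) //; last exact: stable.
  rewrite (log_approx_gt (ltnSn n)) subr0 /f /= eqxx.
  by rewrite (odd_n : ~~ odd n) addrC subrK.
move: odd_n; rewrite /= negbK => odd_n.
rewrite (fps_exp_top (g := fps_even (log_approx n))) ?/fps_even //=; last first.
  by move=> i /stable ->.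
rewrite odd_n /= (log_approx_gt (ltnSn n)) subr0 /f /= eqxx.
by rewrite odd_n addrC subrK.
Qed.

End Prescribed.

End PowerSeries.

(** * Universal property of the polynomial algebra *)

Section Universal.
Variables (I : choiceType) (B : comAlgType rat) (g : I -> B).

Definition cmonom_eval (m : {cmonom I}) : B := \prod_(i <- finsupp m) g i ^+ m i.

Lemma cmonom_evalE (m : {cmonom I}) (S : {fset I}) : (finsupp m `<=` S)%fset ->
  cmonom_eval m = \prod_(i <- S) g i ^+ m i.
Proof.
move=> sub; apply: big_fset_incl => // i _ /fsfun_dflt ->.
exact: expr0.
Qed.

Lemma cmonom_eval_mmorphism : mmorphism cmonom_eval.
Proof.
split=> [x y|]; last by rewrite /cmonom_eval mdom1 big_seq_fset0.
have subl : (finsupp x `<=` finsupp (mmul x y))%fset by rewrite mdomD fsubsetUl.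
have subr : (finsupp y `<=` finsupp (mmul x y))%fset by rewrite mdomD fsubsetUr.
rewrite (cmonom_evalE subl) (cmonom_evalE subr) -big_split.
by apply: eq_bigr => i _; rewrite cmM exprD.
Qed.

HB.instance Definition _ :=
  isMultiplicative.Build _ _ cmonom_eval cmonom_eval_mmorphism.

(** This is the freeness of the variables. Compatibility with rational scalars is recorded because
    the morphism has to pass through the factors 1/m! of [fps_exp]. *)
Lemma malg_universal : exists phi : {rmorphism {malg rat[{cmonom I}]} -> B},
  (forall c x, phi (c *: x) = c *: phi x) /\
  (forall i, phi << ucm i >> = g i).
Proof.
exists (mmap (in_alg B) cmonom_eval); split=> [c x|i].
  by rewrite -[RHS]mulr_algl; apply: mmapZ.
apply: etrans (mmapU _ _) _.
by rewrite /= scale1r mul1r /cmonom_eval mdomU big_seq_fset1 cmUU expr1.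
Qed.

End Universal.

Lemma rmorph_fps_exp (A B : comAlgType rat) (phi : {rmorphism A -> B}) f n :
    (forall (c : rat) x, phi (c *: x) = c *: phi x) ->
  phi (fps_exp f n) = fps_exp (fun i => phi (f i)) n.
Proof.
move=> phiZ; rewrite /fps_exp rmorph_sum; apply: eq_bigr => m _ /=.
rewrite phiZ; congr (_ *: _); move: (nat_of_ord m) => {}m.
elim: m n => [|k IHk] n /=; first by rewrite rmorph_nat.
by rewrite rmorph_sum; apply: eq_bigr => i _; rewrite rmorphM IHk.
Qed.

(** * The relation between [hath] and [barh] *)

Lemma hathE n : hath n = fps_exp (hlog (fun=> 1)) n. Proof. by []. Qed.

Lemma barhE n : barh n = fps_exp (fps_even (hlog (fun=> 1))) n.
Proof.
apply: eq_fps_exp => -[|i]; rewrite /fps_even //= if_neg.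
by case: ifP => _ //; rewrite mul0r mulr0 scale0r.
Qed.

Lemma barh0 : barh 0 = 1. Proof. exact: fps_exp0. Qed.

Lemma barh_odd n : odd n -> barh n = 0.
Proof. by rewrite barhE; apply: fps_exp_even_odd. Qed.

(** This is the coefficient of u^(2k+2) in E(u) E(-u) = B(u)^2. Independence solves it for the top
    term [hath n], spanning for the square of [hath k.+1]. *)
Lemma hath_sqr k : let n := k.+1.*2 in
  (-1) ^+ k.+1 * (hath k.+1 * hath k.+1)
      + (hath n + \sum_(i < k) (-1) ^+ i.+1 * (hath i.+1 * hath (n - i.+1))) *+ 2
    = barh k.+1 * barh k.+1
      + (barh n + \sum_(i < k) barh i.+1 * barh (n - i.+1)) *+ 2.
Proof.
move=> n; have log0 : hlog (fun=> 1) 0%N = 0 by [].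
under [in RHS]eq_bigr => i _ do rewrite !barhE.
by rewrite !barhE; apply: (fps_exp_reflect_doubleS k log0).
Qed.

Lemma hath_barh_prescribed (t : nat -> Qh) :
  exists phi : {rmorphism Qh -> Qh},
    (forall n, odd n -> phi (hath n) = t n) /\
    (forall n, ~~ odd n -> (0 < n)%N -> phi (barh n) = t n).
Proof.
have [f [f0 f_odd f_even]] := fps_exp_prescribed t.
(* The scalar inverts the factor (-1)^(r-1)/r of [hlog], so that [phi] sends the logarithm of E to
   [f]. *)
pose g (r : posnat) : Qh := ((-1) ^+ (val r).-1 * (val r)%:R) *: f (val r).
have [phi [phiZ phih]] : exists phi : {rmorphism Qh -> Qh},
    (forall (c : rat) x, phi (c *: x) = c *: phi x) /\ (forall r, phi (h r) = g r).
  exact: malg_universal g.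
have phi_log n : phi (hlog (fun=> 1) n) = f n.
  case: n => [|n]; first by rewrite rmorph0.
  rewrite phiZ phih /g /= scalerA mulrACA -expr2 sqrr_sign mul1r mul1r mulVf ?scale1r //.
  by rewrite Num.Theory.pnatr_eq0.
exists phi; split=> n odd_n; last move=> n_gt0.
  rewrite hathE (rmorph_fps_exp _ _ phiZ) -(f_odd _ odd_n).
  by apply: eq_fps_exp; apply: phi_log.
rewrite barhE (rmorph_fps_exp _ _ phiZ) -(f_even _ odd_n n_gt0).
apply: eq_fps_exp => i; rewrite /fps_even; case: ifP => _; first exact: rmorph0.
exact: phi_log.
Qed.

(** * Linear independence *)

Definition Zpoly : {pred Qh} := fun x => x \is a monalgOver Num.int.

Lemma ZpolyP (x : Qh) : reflect (forall m, x@_m \is a Num.int) (x \in Zpoly).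
Proof. exact: monalgOverP. Qed.

Lemma Zpoly_subring : subring_closed Zpoly.
Proof.
split=> [|x y /ZpolyP Zx /ZpolyP Zy|x y].
- by apply/ZpolyP => m; rewrite mcoeff1 rpred_nat.
- by apply/ZpolyP => m; rewrite mcoeffB rpredB.
exact: (monalgOver_mulr_closed _ _).2.
Qed.
HB.instance Definition _ := GRing.isSubringClosed.Build Qh Zpoly Zpoly_subring.

Lemma Zpoly_mon (m : {cmonom posnat}) : (<< m >> : Qh) \in Zpoly.
Proof. by apply/ZpolyP => m'; rewrite mcoeffU1 rpred_nat. Qed.

(** For n = 2^a m with m odd, this is the monomial h_m^(2^a). *)
Definition lead_mon (n : nat) : {cmonom posnat} :=
  \big[mmul/mone]_(i < (n`_2)%N) ucm (posS (n`_2^')%N.-1).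

Lemma cmonom_prodE (J : Type) (s : seq J) (F : J -> {cmonom posnat}) r :
  (\big[mmul/mone]_(j <- s) F j) r = (\sum_(j <- s) F j r)%N.
Proof.
by elim/big_rec2: _ => [|j n m _ <-]; [exact: cm1 | exact: cmM].
Qed.

Lemma lead_monE n r : (0 < n)%N -> lead_mon n r = ((n`_2^' == val r) * n`_2)%N.
Proof.
move=> n_gt0; rewrite /lead_mon cmonom_prodE sum_nat_const card_ord cmU mulnC.
by rewrite -val_eqE /= prednK // part_gt0.
Qed.

Lemma lead_mon_odd n : odd n -> lead_mon n = ucm (posS n.-1).
Proof.
move=> odd_n; have p'n : (2^'.-nat n)%N by rewrite p'natE // dvdn2 odd_n.
by rewrite /lead_mon part_p'nat // big_ord1 part_pnat_id.
Qed.

(** Doubling [n] keeps the odd part and doubles the exponent, so leading monomials follow the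
    recursion by squares of [mod2_squares]. *)
Lemma lead_mon_double n : (0 < n)%N ->
  lead_mon n.*2 = mmul (lead_mon n) (lead_mon n).
Proof.
move=> n_gt0; apply/eqP/cmP => r; rewrite cmM !lead_monE ?double_gt0 //.
have p2 : (2`_2)%N = 2%N by rewrite part_pnat_id.
have p'2 : (2`_2^')%N = 1%N by rewrite part_p'nat.
by rewrite -mul2n !partnM // p2 p'2 mul1n mul2n addnn doubleMr.
Qed.

Lemma malgU1M (K : monomType) (R : nzRingType) (m m' : K) :
  (<< mmul m m' >> : {malg R[K]}) = << m >> * << m' >>.
Proof.
by rewrite [RHS]malgME !msuppU1 !big_seq_fset1 !mcoeffUU mulr1.
Qed.

Lemma monM (m m' : {cmonom posnat}) :
  (<< mmul m m' >> : Qh) = << m >> * << m' >>.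
Proof. exact: malgU1M. Qed.

(** The reflection relation solved for the top term [E]: [s] is the sign, [(m + z *+ 2) *+ 2] and
    [y *+ 4] are the values at k+1. Modulo 4 only -2 s m^2 survives. The factor 2 left on both sides
    is cancelled afterwards. *)
Lemma hath_double_mod4 (A : comAlgType rat) (s m z y y2 s1 s2 E : A) :
    s * ((m + z *+ 2) *+ 2 * ((m + z *+ 2) *+ 2)) + (E + s1 *+ 4) *+ 2
      = y *+ 4 * (y *+ 4) + (y2 *+ 4 + s2 *+ 4) *+ 2 ->
  E *+ 2 = ((- s * (m * m) *+ 2 + (y * y *+ 2 + y2 + s2 - s1
                 - s * (m * z + z * z) *+ 2) *+ 4)) *+ 2.
Proof.
move=> eqE; transitivity (y *+ 4 * (y *+ 4) + (y2 *+ 4 + s2 *+ 4) *+ 2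
  - s * ((m + z *+ 2) *+ 2 * ((m + z *+ 2) *+ 2)) - s1 *+ 4 *+ 2).
  by rewrite -eqE; ring.
by ring.
Qed.

Lemma rmorph_reflect (A B : comNzRingType) (phi : {rmorphism A -> B})
    (e b : nat -> A) (k n : nat) :
    (-1) ^+ k.+1 * (e k.+1 * e k.+1)
        + (e n + \sum_(i < k) (-1) ^+ i.+1 * (e i.+1 * e (n - i.+1)%N)) *+ 2
      = b k.+1 * b k.+1 + (b n + \sum_(i < k) b i.+1 * b (n - i.+1)%N) *+ 2 ->
    (-1) ^+ k.+1 * (phi (e k.+1) * phi (e k.+1))
        + (phi (e n) + \sum_(i < k) (-1) ^+ i.+1
             * (phi (e i.+1) * phi (e (n - i.+1)%N))) *+ 2
      = phi (b k.+1) * phi (b k.+1)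
        + (phi (b n) + \sum_(i < k) (phi (b i.+1) * phi (b (n - i.+1)%N))) *+ 2.
Proof.
move/(congr1 phi).
rewrite !(rmorphD, rmorphMn, rmorph_sum, rmorphM, rmorphXn, rmorphN1) /=.
under eq_bigr => i _ do rewrite !(rmorphM, rmorphXn, rmorphN1).
by under [in RHS]eq_bigr => i _ do rewrite rmorphM.
Qed.

(** At n = 2(k+1), the mixed products and all [B] terms contribute multiples of 8 to the relation.
    Halving it leaves E_n equal to 2 M_(k+1)^2 modulo 4, where the sign is invisible. *)
Lemma mod2_squares (A : comAlgType rat) (S : subringClosed A) (E B M : nat -> A) :
    (forall k, let n := k.+1.*2 in
       (-1) ^+ k.+1 * (E k.+1 * E k.+1)
         + (E n + \sum_(i < k) (-1) ^+ i.+1 * (E i.+1 * E (n - i.+1)%N)) *+ 2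
       = B k.+1 * B k.+1 + (B n + \sum_(i < k) B i.+1 * B (n - i.+1)%N) *+ 2) ->
    (forall n, (0 < n)%N -> exists2 y, y \in S & B n = y *+ 4) ->
    (forall n, odd n -> E n = M n *+ 2) ->
    (forall n, (0 < n)%N -> M n.*2 = M n * M n) ->
    (forall n, M n \in S) ->
  forall n, (0 < n)%N -> exists2 z, z \in S & E n = (M n + z *+ 2) *+ 2.
Proof.
move=> rel B4 E_odd M_double SM; elim/ltn_ind=> n IHn n_gt0.
case: (boolP (odd n)) => odd_n.
  by exists 0; rewrite ?rpred0 // mul0rn addr0 E_odd.
have E2 i : (0 < i < n)%N -> exists2 w, w \in S & E i = w *+ 2.
  case/andP=> i_gt0 lt_in; have [z Sz ->] := IHn i lt_in i_gt0.
  by exists (M i + z *+ 2); rewrite // rpredD ?rpredMn.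
have{odd_n} [k def_n] : exists k, n = k.+1.*2.
  case: n n_gt0 odd_n {IHn E2} => [|[|n]] //= _; rewrite !negbK => ev_n.
  by exists n./2; rewrite doubleS even_halfK.
(* Both indices of a mixed product lie strictly between 0 and [n], so both factors are even. *)
have sum4 (c G : nat -> A) : (forall i, c i \in S) ->
    (forall i, (0 < i < n)%N -> exists2 w, w \in S & G i = w *+ 2) ->
  exists2 w, w \in S &
    \sum_(i < k) c i * (G i.+1 * G (n - i.+1)%N) = w *+ 4.
  move=> Sc Gw; apply: (big_ind (fun x => exists2 w, w \in S & x = w *+ 4)).
  - by exists 0; rewrite ?rpred0 ?mul0rn.
  - by move=> x y [w Sw ->] [w' Sw' ->]; exists (w + w'); rewrite ?rpredD ?mulrnDl.
  move=> i _; have lt_ik : (i < k)%N := ltn_ord i.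
  have [|w Sw ->] := Gw i.+1; first by rewrite def_n; lia.
  have [|w' Sw' ->] := Gw (n - i.+1)%N; first by rewrite def_n; lia.
  exists (c i * (w * w')); first by rewrite !rpredM.
  by rewrite mulrnAl !mulrnAr -mulrnA.
have [s1 Ss1 def_s1] := sum4 (fun i => (-1) ^+ i.+1) E
  (fun i => rpredX i.+1 (rpredN1 S)) E2.
have [|i /andP[i_gt0 _]|s2 Ss2 def_s2] := sum4 (fun=> 1) B.
- by move=> _; apply: rpred1.
- have [y Sy ->] := B4 i i_gt0.
  by exists (y *+ 2); rewrite ?rpredMn // -mulrnA.
have {}def_s2 : \sum_(i < k) B i.+1 * B (n - i.+1)%N = s2 *+ 4.
  by rewrite -def_s2; apply: eq_bigr => i _; rewrite mul1r.
have [y Sy def_y] := B4 k.+1 isT.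
have [y2 Sy2 def_y2] := B4 n n_gt0.
have [|z Sz def_z] := IHn k.+1 _ isT; first by rewrite def_n; lia.
have := rel k; rewrite -def_n /= def_s1 def_s2 def_y def_y2 def_z.
move=> /hath_double_mod4 /mulrSnI ->; rewrite {1}def_n M_double //.
set w := (X in X *+ 4); have Sw : w \in S.
  by rewrite !(rpredD, rpredN, rpredMn, rpredM, rpredX, rpred1) //; apply: SM.
(* The sign in front of the square is (-1)^k = 1 - 2 (odd k); its deviation from 1 is absorbed into
   the remainder. *)
exists (w - (odd k)%:R * (M k.+1 * M k.+1)).
  by rewrite rpredB ?rpredM ?rpred_nat ?SM.
rewrite -[(-1) ^+ k.+1]signr_odd /=; clearbody w.
by case: (odd k); rewrite /= ?(expr0, expr1, mulr1n, mulr0n); ring.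
Qed.

(** The values 2 h_n at odd [n] start the induction of [mod2_squares]; the values 4 h_n at even [n]
    provide its divisibility hypothesis on [barh]. *)
Lemma hath_lead : exists phi : {rmorphism Qh -> Qh},
  (forall n, (0 < n)%N -> exists2 z, z \in Zpoly &
     phi (hath n) = (<< lead_mon n >> + z *+ 2) *+ 2) /\
  (forall n, (0 < n)%N -> phi (barh n.*2) = h (posS n.*2.-1) *+ 4).
Proof.
have [phi [phi_hath phi_barh]] := hath_barh_prescribed
  (fun n => h (posS n.-1) *+ (if odd n then 2 else 4)).
exists phi; split; last first.
  by move=> n n_gt0; rewrite phi_barh ?odd_double ?double_gt0.
pose M n : Qh := << lead_mon n >>.
apply: (@mod2_squares Qh Zpoly (fun n => phi (hath n)) (fun n => phi (barh n)) M).
- by move=> k; apply: (@rmorph_reflect Qh Qh phi hath barh k k.+1.*2 (hath_sqr k)).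
- move=> n n_gt0; case: (boolP (odd n)) => odd_n.
    by exists 0; rewrite ?rpred0 // barh_odd // rmorph0 mul0rn.
  exists (h (posS n.-1)); first exact: Zpoly_mon.
  by rewrite phi_barh // (negPf odd_n).
- by move=> n odd_n; rewrite phi_hath // odd_n /M lead_mon_odd.
- by move=> n n_gt0; rewrite /M lead_mon_double // monM.
by move=> n; apply: Zpoly_mon.
Qed.

(** Finite choice along a list, proved by induction: the witnesses to be selected are only known to
    exist as propositions. *)
Lemma seq_choice (I : eqType) (T : Type) (y0 : T) (s : seq I) (P : I -> T -> Prop) :
  (forall i, i \in s -> exists y, P i y) -> exists f, forall i, i \in s -> P i (f i).
Proof.
elim: s => [|i s IHs] Ps; first by exists (fun=> y0).
have [|f Pf] := IHs; first by move=> j js; apply: Ps; rewrite inE js orbT.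
have [y Py] := Ps i (mem_head i s).
exists (fun j => if j == i then y else f j) => j; rewrite inE.
by case: eqP => [->|_] //= /Pf.
Qed.

(* Reading the relation modulo 2 shows all the [q i] even, and their halves satisfy
   the same relation. *)
Lemma dvdz_coef_mon (I : eqType) (s : seq I) (m : I -> {cmonom posnat})
    (z : I -> Qh) (K : nat) (q : I -> int) :
    uniq s -> injective m -> (forall i, i \in s -> z i \in Zpoly) ->
    \sum_(i <- s) (<< m i >> + z i *+ 2) *~ q i = 0 ->
  forall i, i \in s -> (2 ^+ K %| q i)%Z.
Proof.
move=> uniq_s inj_m Zz; elim: K q => [|K IHK] q sum0 j js.
  by rewrite expr0 dvd1z.
have even_q i : i \in s -> (2 %| q i)%Z.
  move=> i_s; have := congr1 (mcoeff (m i)) sum0.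
  rewrite mcoeff0 raddf_sum /= (eq_bigr (fun k =>
    (m k == m i)%:R *~ q k + (z k)@_(m i) *~ q k *+ 2)%R); last first.
    move=> k _; rewrite raddfMz /= mcoeffD mcoeffU1 mcoeffMn mulrzDl.
    by rewrite [_ *+ 2]pmulrn mulrzAC -pmulrn.
  rewrite big_split /= sumrMnl (bigD1_seq i) //= eqxx big1 ?addr0; last first.
    by move=> k /negPf k_i; rewrite (inj_eq inj_m) k_i mul0rz.
  have /Num.Theory.intrP [t ->] :
      \sum_(k <- s) (z k)@_(m i) *~ q k \is a Num.int.
    rewrite big_seq rpred_sum // => k ks; rewrite rpredMz //.
    by have /ZpolyP := Zz k ks.
  rewrite mulr1n -(rmorphMn intr) -rmorphD /= => /eqP.
  rewrite intr_eq0 => /eqP q_t; apply/dvdzP; exists (- t); lia.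
have sum0' : \sum_(i <- s) (<< m i >> + z i *+ 2) *~ (q i %/ 2)%Z = 0.
  apply: (@mulrSnI Qh 1); rewrite mul0rn -sumrMnl -[RHS]sum0.
  apply: eq_big_seq => i i_s.
  by rewrite pmulrn -mulrzA divzK ?even_q.
rewrite -(divzK (even_q j js)) exprSr dvdz_mul //.
exact: IHK sum0' j js.
Qed.

(** The power of 2 and the integral remainder are packed into one pair so that [seq_choice] can
    select both at once. *)
Definition lead_at (x : Qh) (m : {cmonom posnat}) (Nz : nat * Qh) : Prop :=
  Nz.2 \in Zpoly /\ x = (<< m >> + Nz.2 *+ 2) *+ (2 ^ Nz.1).

(** The powers of 2 are absorbed into the coefficients, which [dvdz_coef_mon] then shows divisible
    by every power of 2. *)
Lemma lead_at_indep (I : eqType) (s : seq I) (x : I -> Qh)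
    (m : I -> {cmonom posnat}) (n : I -> int) :
    uniq s -> injective m -> (forall i, exists Nz, lead_at (x i) (m i) Nz) ->
    \sum_(i <- s) x i *~ n i = 0 ->
  forall i, i \in s -> n i = 0.
Proof.
move=> uniq_s inj_m lead_x sum0 j js.
have [f fP] := seq_choice (0%N, 0 : Qh) (fun i (_ : i \in s) => lead_x i).
pose q i : int := n i * (2 ^ (f i).1)%N.
have : \sum_(i <- s) (<< m i >> + (f i).2 *+ 2) *~ q i = 0.
  rewrite -[RHS]sum0; apply: eq_big_seq => i /fP [_ ->].
  by rewrite /q mulrC mulrzA -pmulrn.
(* The exponent |q j| suffices: 2^|q j| exceeds |q j|, so divisibility forces [q j] to vanish. *)
move=> /(@dvdz_coef_mon _ _ _ (fun i => (f i).2) `|q j|%N q uniq_s inj_m) dvd_q.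
have {dvd_q} := dvd_q (fun i i_s => proj1 (fP i i_s)) j js.
rewrite /dvdz abszX /= => /dvdn_leq; case: (posnP `|q j|%N) => [|_ /(_ isT)].
  move/eqP; rewrite absz_eq0 mulf_eq0 => /orP[/eqP->//|].
  by rewrite eqz_nat expn_eq0.
by rewrite leqNgt ltn_expl.
Qed.

Lemma lead_at1 : exists Nz, lead_at 1 mone Nz.
Proof. by exists (0%N, 0); split; rewrite ?rpred0 // mul0rn addr0 mulr1n. Qed.

Lemma mul_mod2 (A : comNzRingType) (a b z z' : A) (N N' : nat) :
  (a + z *+ 2) *+ (2 ^ N) * ((b + z' *+ 2) *+ (2 ^ N'))
    = (a * b + (a * z' + z * b + (z * z') *+ 2) *+ 2) *+ (2 ^ (N + N')).
Proof.
rewrite expnD mulrnA mulrnAr mulrnAl.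
by congr (_ *+ _ *+ _); ring.
Qed.

Lemma lead_atM x y m m' :
    (exists Nz, lead_at x m Nz) -> (exists Nz, lead_at y m' Nz) ->
  exists Nz, lead_at (x * y) (mmul m m') Nz.
Proof.
move=> [[N z] [/= Zz ->]] [[N' z'] [/= Zz' ->]].
exists ((N + N')%N, << m >> * z' + z * << m' >> + (z * z') *+ 2); split=> /=.
  by rewrite !(rpredD, rpredMn, rpredM) ?Zpoly_mon.
by rewrite monM; apply: mul_mod2.
Qed.

Lemma lead_at_prod (J : Type) (s : seq J) (F : J -> Qh) (m : J -> {cmonom posnat}) :
    (forall j, exists Nz, lead_at (F j) (m j) Nz) ->
  exists Nz, lead_at (\prod_(j <- s) F j) (\big[mmul/mone]_(j <- s) m j) Nz.
Proof.
move=> lead_F; apply: (big_rec2 (fun x m => exists Nz, lead_at x m Nz)).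
  exact: lead_at1.
by move=> j m' x _; apply: lead_atM.
Qed.

Lemma lead_at_exp x m n : (exists Nz, lead_at x m Nz) ->
  exists Nz, lead_at (x ^+ n) (\big[mmul/mone]_(i < n) m) Nz.
Proof.
by move=> lead_x; rewrite -[n in x ^+ n]card_ord -prodr_const; apply: lead_at_prod.
Qed.

(** * Binary expansions and injectivity of the leading monomials *)

Lemma sum_pow2_bounded N (f g : nat -> bool) :
    (\sum_(a < N) f a * 2 ^ a = \sum_(a < N) g a * 2 ^ a)%N ->
  forall a, (a < N)%N -> f a = g a.
Proof.
elim: N f g => [|N IHN] f g //.
have low (k : nat -> bool) : (\sum_(a < N.+1) k a * 2 ^ a
    = k 0%N + (\sum_(a < N) k a.+1 * 2 ^ a).*2)%N.
  rewrite big_ord_recl muln1 -muln2 big_distrl; congr (_ + _)%N.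
  by apply: eq_bigr => a _; rewrite /= expnSr mulnA.
rewrite !low => eq_fg.
(* The lowest bit is the parity of the sum; removing it and halving shifts the remaining bits. *)
have eq0 : f 0%N = g 0%N.
  by have := congr1 odd eq_fg; rewrite !oddD !odd_double !addbF !oddb.
move: eq_fg; rewrite eq0 => /addnI /double_inj eq_fg [|a] //.
exact: (IHN (fun a => f a.+1) (fun a => g a.+1) eq_fg a).
Qed.

Lemma sum_pow2_inj (s t : seq nat) : uniq s -> uniq t ->
  (\sum_(a <- s) 2 ^ a = \sum_(a <- t) 2 ^ a)%N -> s =i t.
Proof.
move=> uniq_s uniq_t eq_st; pose N := (\max_(a <- s ++ t) a).+1.
have ltN a : a \in s ++ t -> (a < N)%N by move=> st_a; apply: leq_bigmax_seq.
have sumE (r : seq nat) : uniq r -> {subset r <= s ++ t} ->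
    (\sum_(a <- r) 2 ^ a = \sum_(a < N) (nat_of_ord a \in r) * 2 ^ a)%N.
  move=> uniq_r sub_r; rewrite -(big_mkord xpredT (fun a => (a \in r) * 2 ^ a)%N).
  rewrite [RHS](eq_bigr (fun a => if a \in r then 2 ^ a else 0)%N); last first.
    by move=> a _; case: (a \in r); rewrite ?mul1n ?mul0n.
  rewrite -[RHS]big_mkcond -[RHS]big_filter; apply: perm_big; apply: uniq_perm => //.
    by rewrite filter_uniq ?iota_uniq.
  move=> a; rewrite mem_filter mem_index_iota /=; case: (boolP (a \in r)) => //.
  by move/sub_r/ltN->.
have sub_s : {subset s <= s ++ t} by move=> a; rewrite mem_cat => ->.
have sub_t : {subset t <= s ++ t} by move=> a; rewrite mem_cat orbC => ->.
move: eq_st; rewrite !sumE // => /sum_pow2_bounded eq_st a.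
case: (ltnP a N) => [/eq_st //|]; rewrite leqNgt => /negP ge_a.
by apply/idP/idP => [/sub_s/ltN|/sub_t/ltN] /ge_a.
Qed.

(** The leading monomial of the image of [Bqpol p], written in the shape that [lead_at_prod] and
    [lead_at_exp] produce. *)
Definition bq_mon
    (p : {fsfun posnat -> bool with false} * {fsfun posnat -> nat with 0%N}) :
    {cmonom posnat} :=
  mmul (\big[mmul/mone]_(k <- finsupp p.1) \big[mmul/mone]_(i < p.1 k) lead_mon (val k))
       (\big[mmul/mone]_(k <- finsupp p.2)
          \big[mmul/mone]_(i < p.2 k) ucm (posS (2 * val k).-1)).

Lemma bq_monE p r : (bq_mon p r
  = \sum_(k <- finsupp p.1 | (val k)`_2^' == val r) (val k)`_2
    + \sum_(k <- finsupp p.2) p.2 k * (2 * val k == val r))%N.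
Proof.
rewrite /bq_mon cmM !cmonom_prodE; congr (_ + _)%N.
  rewrite [RHS]big_mkcond; apply: eq_big_seq => k; rewrite mem_finsupp.
  rewrite cmonom_prodE sum_nat_const card_ord lead_monE ?(valP k) //.
  by case: (p.1 k) => // _; rewrite mul1n; case: ifP => _; rewrite ?mul1n.
apply: eq_bigr => k _; rewrite cmonom_prodE sum_nat_const card_ord cmU.
by rewrite -val_eqE /= prednK // muln_gt0 (valP k).
Qed.

Lemma odd_part2' n : (0 < n)%N -> odd (n`_2^')%N.
Proof.
move=> n_gt0; have := part_pnat (2^')%N n.
by rewrite p'natE // dvdn2 negbK.
Qed.

(** Variables of even index come only from the [barh] factors, and their exponents are the values of
    [p.2]. At an odd [r] the exponent is the sum of the 2^a with 2^a r in the support of [p.1],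
    which determines these a. *)
Lemma bq_mon_inj : injective bq_mon.
Proof.
move=> p p' eq_pp'; have eq_at r : bq_mon p r = bq_mon p' r by rewrite eq_pp'.
have d_at q (k : posnat) : bq_mon q (posS (2 * val k).-1) = q.2 k.
  rewrite bq_monE big1 => [|i /eqP]; last first.
    have := odd_part2' (valP i); rewrite /= prednK ?muln_gt0 ?(valP k) // => odd_i eq_i.
    by move: odd_i; rewrite eq_i oddM.
  rewrite add0n (eq_bigr (fun i => if i == k then q.2 k else 0)%N); last first.
    move=> i _; rewrite /= prednK ?muln_gt0 ?(valP k) // eqn_pmul2l // val_eqE.
    by case: eqP => [->|_]; rewrite ?muln1 ?muln0.
  case: (finsuppP q.2 k) => [k_q|k_q].
    by rewrite big1 // => i _; rewrite if_same.
  rewrite (bigD1_seq k) //= ?eqxx ?fset_uniq // big1 ?addn0 // => i /negPf-> //.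
have e_at q (r : posnat) : odd (val r) ->
    bq_mon q r
      = (\sum_(a <- [seq logn 2 (val k) | k <- finsupp q.1 & ((val k)`_2^' == val r)%N])
                   2 ^ a)%N.
  move=> odd_r; rewrite bq_monE [X in (_ + X)%N]big1 ?addn0; last first.
    move=> k _; case: eqP => [eq_r|_]; last by rewrite muln0.
    by rewrite -eq_r oddM in odd_r.
  rewrite big_map big_filter; apply: eq_bigr => k _.
  by rewrite p_part.
(* Indices with the same odd part are separated by their 2-adic valuation, so the powers of 2 in the
   sum are distinct. *)
have uniq_log (e : {fsfun posnat -> bool with false}) (r : posnat) :
    uniq [seq logn 2 (val k) | k <- finsupp e & ((val k)`_2^' == val r)%N].
  rewrite map_inj_in_uniq ?filter_uniq ?fset_uniq // => k k'.
  rewrite !mem_filter => /andP[/eqP kr _] /andP[/eqP k'r _] eq_log.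
  apply: val_inj; rewrite -(partnC 2%N (valP k)) -(partnC 2%N (valP k')) kr k'r.
  by rewrite !p_part eq_log.
have sub_supp q q' : (forall r, bq_mon q r = bq_mon q' r) ->
    {subset finsupp q.1 <= finsupp q'.1}.
  move=> eq_q k kq; pose r := posS ((val k)`_2^')%N.-1.
  have val_r : val r = ((val k)`_2^')%N by rewrite /= prednK // part_gt0.
  have odd_r : odd (val r) by rewrite val_r odd_part2' // (valP k).
  have := eq_q r; rewrite !e_at // => /sum_pow2_inj eq_log.
  have {}eq_log := eq_log (uniq_log _ _) (uniq_log _ _).
  have : logn 2 (val k) \in
      [seq logn 2 (val k) | k <- finsupp q.1 & ((val k)`_2^' == val r)%N].
    by apply: map_f; rewrite mem_filter val_r eqxx.
  rewrite eq_log => /mapP [k']; rewrite mem_filter val_r => /andP[/eqP k'r k'q] eq_k.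
  suff -> : k = k' by [].
  apply: val_inj; rewrite -(partnC 2%N (valP k)) -(partnC 2%N (valP k')) k'r.
  by rewrite !p_part eq_k.
have eq_supp : finsupp p.1 = finsupp p'.1.
  by apply/fsetP => k; apply/idP/idP; apply: sub_supp => // r; rewrite eq_at.
rewrite [p]surjective_pairing [p']surjective_pairing; congr (_, _).
  (* A boolean function is determined by its support. *)
  apply/fsfunP => k; have /fsetP/(_ k) := eq_supp; rewrite !mem_finsupp.
  by case: (p.1 k) (p'.1 k) => [] [].
by apply/fsfunP => k; rewrite -!d_at eq_at.
Qed.

Lemma Bqpol_indep (s : seq ({fsfun posnat -> bool with false}
                          * {fsfun posnat -> nat with 0%N})) (n : _ -> int) :
    uniq s -> \sum_(p <- s) Bqpol p *~ n p = 0 -> forall p, p \in s -> n p = 0.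
Proof.
move=> uniq_s sum0; have [phi [phi_hath phi_barh]] := hath_lead.
have lead_hath (k : posnat) :
    exists Nz, lead_at (phi (hath (val k))) (lead_mon (val k)) Nz.
  by have [z Zz ->] := phi_hath _ (valP k); exists (1%N, z).
have lead_barh (k : posnat) :
    exists Nz, lead_at (phi (barh (2 * val k))) (ucm (posS (2 * val k).-1)) Nz.
  (* The image is exactly 4 h_(2k): power 2^2, zero remainder. *)
  exists (2%N, 0); split; rewrite ?rpred0 //= mul0rn addr0 mul2n.
  by rewrite phi_barh // (valP k).
apply: (lead_at_indep (x := fun p => phi (Bqpol p)) uniq_s bq_mon_inj) => [p|].
  rewrite /Bqpol rmorphM; apply: lead_atM.
    rewrite /hat_prod rmorph_prod; apply: lead_at_prod => k.
    by rewrite rmorphXn; apply: lead_at_exp (lead_hath k).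
  rewrite /bar_prod rmorph_prod; apply: lead_at_prod => k.
  by rewrite rmorphXn; apply: lead_at_exp (lead_barh k).
have := congr1 phi sum0; rewrite rmorph_sum rmorph0 => sum1.
apply: etrans sum1.
by apply: eq_bigr => p _; rewrite rmorphMz.
Qed.

(** * Spanning *)

Section LinearSpan.
Variables (C V : zmodType) (act : C -> V -> V) (K : C -> Prop).
Variables (I : choiceType) (b : I -> V).

(** An inductive span lets closure properties be proved by induction; [lin_span_fsfun] converts it
    to finitely supported families at the end. *)
Inductive lin_span : V -> Prop :=
| lin_span0 : lin_span 0
| lin_span_gen c i : K c -> lin_span (act c (b i))
| lin_spanD x y : lin_span x -> lin_span y -> lin_span (x + y).

Hypotheses (K0 : K 0) (KD : forall c c', K c -> K c' -> K (c + c')).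
Hypotheses (act0 : forall v, act 0 v = 0)
  (actD : forall c c' v, act (c + c') v = act c v + act c' v).

Lemma lin_span_fsfun x : lin_span x ->
  exists c : {fsfun I -> C with 0},
    (forall i, K (c i)) /\ x = \sum_(i <- finsupp c) act (c i) (b i).
Proof.
move=> span_x; have {span_x} [s [Ks ->]] : exists s : seq (C * I),
    (forall p, p \in s -> K p.1) /\ x = \sum_(p <- s) act p.1 (b p.2).
  elim: span_x => [|c i Kc|y z _ [s [Ks ->]] _ [t [Kt ->]]].
  - by exists [::]; rewrite big_nil.
  - by exists [:: (c, i)]; rewrite big_seq1; split=> // p /[!inE] /eqP->.
  exists (s ++ t); rewrite big_cat; split=> // p.
  by rewrite mem_cat => /orP[/Ks|/Kt].
pose S := seq_fset tt [seq p.2 | p <- s].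
(* Coefficients attached to the same index are added. They may cancel, so the support of [c] can be
   smaller than [S]. *)
pose c := [fsfun i in S => \sum_(p <- s | p.2 == i) p.1 | 0] : {fsfun I -> C with 0}.
have cE i : c i = if i \in S then \sum_(p <- s | p.2 == i) p.1 else 0.
  by rewrite fsfunE.
exists c; split=> [i|].
  rewrite cE; case: ifP => // _; rewrite big_seq_cond.
  by apply: big_ind => // p /andP[/Ks].
have -> : \sum_(i <- finsupp c) act (c i) (b i) = \sum_(i <- S) act (c i) (b i).
  apply: big_fset_incl => [|i _ /fsfun_dflt ->]; last exact: act0.
  by apply/fsubsetP => i; rewrite mem_finsupp cE; case: ifP; rewrite ?eqxx.
have -> : \sum_(i <- S) act (c i) (b i)
    = \sum_(i <- S) \sum_(p <- s) (if p.2 == i then act p.1 (b p.2) else 0).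
  apply: eq_big_seq => i iS; rewrite cE iS -big_mkcond.
  rewrite (big_morph (act^~ (b i)) (fun c c' => actD c c' (b i)) (act0 (b i))).
  by apply: eq_bigr => p /eqP->.
rewrite exchange_big /=; apply: eq_big_seq => p ps.
have p2S : p.2 \in S by rewrite seq_fsetE map_f.
rewrite (bigD1_seq p.2) ?fset_uniq //=.
by rewrite eqxx big1 ?addr0 // => i /negPf; rewrite eq_sym => ->.
Qed.

End LinearSpan.

Section GeneratedAlgebra.
Variables (A : nzRingType) (S : A -> Prop).

Lemma Zalg_gen0 : Zalg_gen S 0.
Proof. by rewrite -(subrr 1); apply: Zalg_gen_sub; apply: Zalg_gen_1. Qed.

Lemma Zalg_genN x : Zalg_gen S x -> Zalg_gen S (- x).
Proof. by move=> Sx; rewrite -sub0r; apply: Zalg_gen_sub => //; apply: Zalg_gen0. Qed.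

Lemma Zalg_genD x y : Zalg_gen S x -> Zalg_gen S y -> Zalg_gen S (x + y).
Proof. by move=> Sx Sy; rewrite -[y]opprK; apply/Zalg_gen_sub/Zalg_genN. Qed.

Lemma Zalg_genMn x n : Zalg_gen S x -> Zalg_gen S (x *+ n).
Proof.
move=> Sx; elim: n => [|n IHn]; first exact: Zalg_gen0.
by rewrite mulrS; apply: Zalg_genD.
Qed.

Lemma Zalg_genMz x (n : int) : Zalg_gen S x -> Zalg_gen S (x *~ n).
Proof. by case: n => n Sx; [|apply: Zalg_genN]; apply: Zalg_genMn. Qed.

Lemma Zalg_genX x n : Zalg_gen S x -> Zalg_gen S (x ^+ n).
Proof.
move=> Sx; elim: n => [|n IHn]; first exact: Zalg_gen_1.
by rewrite exprS; apply: Zalg_gen_mul.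
Qed.

Lemma Zalg_gen_prod (J : Type) (s : seq J) (F : J -> A) :
  (forall j, Zalg_gen S (F j)) -> Zalg_gen S (\prod_(j <- s) F j).
Proof.
by move=> SF; apply: big_ind => // [|x y]; [apply: Zalg_gen_1|apply: Zalg_gen_mul].
Qed.

End GeneratedAlgebra.

(** Monomials are indexed by lists, so multiplying them is concatenation. The lemma serves twice:
    with scalars in [Zbar] for [Zmix], and with integer scalars for [Zbar]. *)
Lemma Zalg_gen_monomials (A : comNzRingType) (S K : A -> Prop) (I : choiceType)
    (g : I -> A) x :
    K 1 -> (forall y, K y -> K (- y)) -> (forall y z, K y -> K z -> K (y * z)) ->
    (forall y, S y -> K y \/ exists i, y = g i) ->
  Zalg_gen S x -> lin_span *%R K (fun t : seq I => \prod_(i <- t) g i) x.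
Proof.
move=> K1 KN KM KS; set b := fun t : seq I => _.
have b_nil : b [::] = 1 by rewrite /b big_nil.
have spanK y : K y -> lin_span *%R K b y.
  by move=> Ky; rewrite -[y]mulr1 -b_nil; apply: lin_span_gen.
have spanN y : lin_span *%R K b y -> lin_span *%R K b (- y).
  elim=> [|c i Kc|y' z _ IHy _ IHz]; first by rewrite oppr0; apply: lin_span0.
    by rewrite -mulNr; apply: lin_span_gen; apply: KN.
  by rewrite opprD; apply: lin_spanD.
elim=> [y /KS[|[i ->]]||y z _ IHy _ IHz|y z _ IHy _ IHz].
- exact: spanK.
- have -> : g i = 1 * b [:: i] by rewrite /b big_seq1 mul1r.
  exact: lin_span_gen.
- exact: spanK.
- by apply: lin_spanD => //; apply: spanN.
elim: IHy => [|c i Kc|y1 y2 _ IH1 _ IH2]; first by rewrite mul0r; apply: lin_span0.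
  elim: IHz => [|c' j Kc'|z1 z2 _ IH1 _ IH2]; first by rewrite mulr0; apply: lin_span0.
    by rewrite mulrACA /b -big_cat; apply: (lin_span_gen _ b (i ++ j)); apply: KM.
  by rewrite mulrDr; apply: lin_spanD.
by rewrite mulrDl; apply: lin_spanD.
Qed.

Lemma dup_perm (T : eqType) (s : seq T) :
  ~~ uniq s -> exists x t, perm_eq s (x :: x :: t).
Proof.
elim: s => //= x s IHs; rewrite negb_and negbK => /orP[xs|/IHs [y [t eq_st]]].
  by exists x, (rem x s); rewrite perm_cons perm_to_rem.
exists y, (x :: t); rewrite -(perm_cons x) in eq_st; apply: perm_trans eq_st _.
exact/permPl/(perm_catCA [:: x] [:: y; y] t).
Qed.

Lemma Zbar_barh n : Zbar (barh n).
Proof.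
case: (boolP (odd n)) => [odd_n|]; first by rewrite barh_odd //; apply: Zalg_gen0.
move/even_halfK <-; case: n./2 => [|k]; first by rewrite barh0; apply: Zalg_gen_1.
by apply: Zalg_gen_in; exists (posS k); rewrite mul2n.
Qed.

Lemma Zbar_sub_Zmix x : Zbar x -> Zmix x.
Proof.
elim=> [y [r ->]||y z _ My _ Mz|y z _ My _ Mz].
- apply: Zalg_gen_in; exists (posS (2 * val r).-1); right.
  by rewrite /= prednK // muln_gt0 (valP r).
- exact: Zalg_gen_1.
- exact: Zalg_gen_sub.
exact: Zalg_gen_mul.
Qed.

Lemma hat_prod_seq (s : seq posnat) : uniq s ->
  exists eps, \prod_(k <- s) hath (val k) = hat_prod eps.
Proof.
move=> uniq_s.
pose eps := [fsfun k in seq_fset tt s => true | false] :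
  {fsfun posnat -> bool with false}.
have epsE k : eps k = (k \in s) by rewrite fsfunE seq_fsetE; case: ifP.
exists eps; rewrite /hat_prod [RHS](eq_big_seq (fun k => hath (val k))) => [|k];
  last first.
  by rewrite mem_finsupp; case: (eps k).
apply: perm_big; apply: uniq_perm; rewrite ?fset_uniq // => k.
by rewrite mem_finsupp epsE; case: (k \in s).
Qed.

Lemma bar_prod_seq (s : seq posnat) :
  exists d, \prod_(k <- s) barh (2 * val k) = bar_prod d.
Proof.
pose d := [fsfun k in seq_fset tt s => count_mem k s | 0%N] :
  {fsfun posnat -> nat with 0%N}.
have dE k : d k = count_mem k s.
  rewrite fsfunE seq_fsetE; case: ifPn => // /count_memPn //.
exists d; rewrite -prodr_undup_exp_count /bar_prod.
rewrite (eq_bigr (fun k => barh (2 * val k) ^+ d k)) => [|k _]; last first.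
  by rewrite dE.
apply: perm_big; apply: uniq_perm; rewrite ?fset_uniq ?undup_uniq // => k.
by rewrite mem_finsupp dE mem_undup -has_pred1 has_count lt0n.
Qed.

(** * Elimination of squares of the [hath] *)

Lemma sqr_sum_le (s : seq nat) : (\sum_(k <- s) k ^ 2 <= (\sum_(k <- s) k) ^ 2)%N.
Proof.
elim: s => [|k s IHs]; first by rewrite !big_nil.
by rewrite !big_cons; nia.
Qed.

(** The square carries only a sign, which is its own inverse; solving for it requires no division
    and stays over the integers. *)
Lemma span_sqr_step (A : comNzRingType) (M : A -> Prop) (k : nat) (n : nat)
    (e b : nat -> A) (v : A) :
    (forall x y, M x -> M y -> M (x + y)) -> (forall x, M x -> M (- x)) -> M 0 ->
    (-1) ^+ k.+1 * (e k.+1 * e k.+1)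
        + (e n + \sum_(i < k) (-1) ^+ i.+1 * (e i.+1 * e (n - i.+1)%N)) *+ 2
      = b k.+1 * b k.+1 + (b n + \sum_(i < k) b i.+1 * b (n - i.+1)%N) *+ 2 ->
    (forall i j, M (b i * b j * v)) -> (forall i, M (b i * v)) ->
    M (e n * v) -> (forall i, (i < k)%N -> M (e i.+1 * e (n - i.+1)%N * v)) ->
  M (e k.+1 * e k.+1 * v).
Proof.
move=> MD MN M0 rel Mbb Mb Me Mee.
have Msgn i x : M x -> M ((-1) ^+ i * x).
  by move=> Mx; rewrite -signr_odd; case: odd; rewrite ?mulN1r ?mul1r //; apply: MN.
have Msum (F : nat -> A) : (forall i, (i < k)%N -> M (F i)) -> M (\sum_(i < k) F i).
  by move=> MF; apply: big_ind => // i _; apply: MF.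
have -> : e k.+1 * e k.+1 * v = (-1) ^+ k.+1 * ((-1) ^+ k.+1 * (e k.+1 * e k.+1) * v).
  by rewrite -!mulrA [RHS]mulrA -expr2 sqrr_sign mul1r.
rewrite -[(-1) ^+ k.+1 * (e k.+1 * e k.+1)](addrK
  ((e n + \sum_(i < k) (-1) ^+ i.+1 * (e i.+1 * e (n - i.+1)%N)) *+ 2)) rel.
have M2 x : M x -> M (x *+ 2) by move=> Mx; apply: MD.
apply: (Msgn); rewrite mulrBl; apply: (MD); last rewrite mulrnAl; last apply/MN/M2.
  rewrite mulrDl mulrnAl; apply: (MD) => //; apply: (M2).
  rewrite mulrDl mulr_suml; apply: (MD) => //.
  exact: (Msum (fun i => b i.+1 * b (n - i.+1)%N * v)).
rewrite mulrDl mulr_suml; apply: (MD) => //.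
apply: (Msum (fun i => (-1) ^+ i.+1 * (e i.+1 * e (n - i.+1)%N) * v)) => i lt_ik.
by rewrite -mulrA; apply/Msgn/Mee.
Qed.

(** With k+1 = a + b, the pair (a, a + 2b) has the same sum as (a + b, a + b), and its sum of
    squares is larger by 2 b^2. *)
Lemma sqr_spread k i : (i < k)%N ->
  (k.+1 ^ 2 + k.+1 ^ 2 < i.+1 ^ 2 + (k.+1.*2 - i.+1) ^ 2)%N.
Proof.
move=> lt_ik; have [j def_j] : exists j, (k.+1 = i.+1 + j.+1)%N.
  by exists (k - i.+1)%N; lia.
have -> : (k.+1.*2 - i.+1 = i.+1 + (j.+1 + j.+1))%N by lia.
rewrite def_j -!mulnn; move: i.+1 => a; rewrite !mulnDl !mulnDr; lia.
Qed.

Local Notation hat_span := (lin_span (fun s x : Qh => s * x) Zbar hat_prod).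

Lemma hat_spanZ z x : Zbar z -> hat_span x -> hat_span (z * x).
Proof.
move=> Zz; elim=> [|c i Zc|x1 x2 _ IH1 _ IH2].
- by rewrite mulr0; apply: lin_span0.
- by rewrite mulrA; apply: (lin_span_gen _ hat_prod); apply: Zalg_gen_mul.
by rewrite mulrDr; apply: lin_spanD.
Qed.

Lemma hat_spanN x : hat_span x -> hat_span (- x).
Proof. by rewrite -mulN1r; apply: hat_spanZ; apply/Zalg_genN/Zalg_gen_1. Qed.

Definition weight (t : seq posnat) : nat := \sum_(k <- t) val k.

Definition square_weight (t : seq posnat) : nat := \sum_(k <- t) (val k ^ 2)%N.

(** This bound keeps the truncated subtraction in the measure [weight t ^ 2 - square_weight t]
    exact, so the measure drops whenever the sum of squares grows at fixed weight. *)
Lemma square_weight_le t : (square_weight t <= weight t ^ 2)%N.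
Proof. by have := sqr_sum_le (map val t); rewrite !big_map. Qed.

Definition hath_mon (t : seq posnat) : Qh := \prod_(k <- t) hath (val k).

Lemma hath_mon_cons k t : hath_mon (k :: t) = hath (val k) * hath_mon t.
Proof. exact: big_cons. Qed.

(* The relation trades [e_k^2] for terms of smaller weight in the [e]'s or of the
   same weight with a larger sum of squares of the indices. *)
Lemma hath_mon_span t : hat_span (hath_mon t).
Proof.
have [w] := ubnP (weight t); elim: w t => // w IHw t /ltnSE le_w.
have [d] := ubnP (weight t ^ 2 - square_weight t).
elim: d t le_w => // d IHd t le_w /ltnSE le_d.
have [/hat_prod_seq [eps eq_eps]|/dup_perm [k0 [u perm_t]]] := boolP (uniq t).
  rewrite /hath_mon eq_eps -[hat_prod _]mul1r; apply: (lin_span_gen _ hat_prod).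
  exact: Zalg_gen_1.
have [k def_k] : exists k, val k0 = k.+1 by exists (val k0).-1; rewrite prednK ?(valP k0).
have wt : weight t = (k.+1 + (k.+1 + weight u))%N.
  by rewrite /weight (perm_big _ perm_t) !big_cons /= def_k.
have swt : square_weight t = (k.+1 ^ 2 + (k.+1 ^ 2 + square_weight u))%N.
  by rewrite /square_weight (perm_big _ perm_t) !big_cons /= def_k.
have -> : hath_mon t = hath k.+1 * hath k.+1 * hath_mon u.
  by rewrite /hath_mon (perm_big _ perm_t) !big_cons /= def_k mulrA.
(* Removing the repeated pair lowers the weight, so products of [u] with [barh] factors are covered
   by the outer induction. *)
have span_u : hat_span (hath_mon u) by apply: IHw; rewrite wt in le_w; lia.
have le_u := square_weight_le u.
apply: (@span_sqr_step Qh hat_span k k.+1.*2 hath barh (hath_mon u)).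
- exact: lin_spanD.
- exact: hat_spanN.
- exact: lin_span0.
- exact: hath_sqr.
- by move=> i j; apply: hat_spanZ span_u; apply: Zalg_gen_mul; apply: Zbar_barh.
- by move=> i; apply: hat_spanZ span_u; apply: Zbar_barh.
(* Merging the pair into the single index 2(k+1) keeps the weight and raises the sum of squares. *)
- have := IHd (posS k.+1.*2.-1 :: u); rewrite hath_mon_cons /weight /square_weight.
  rewrite !big_cons -/(weight u) -/(square_weight u) /=.
  by apply; nia.
move=> i lt_ik; have pos : (0 < k.+1.*2 - i.+1)%N by lia.
pose r : posnat := exist _ (k.+1.*2 - i.+1)%N pos; pose t' := [:: posS i, r & u].
have wt' : weight t' = (i.+1 + (k.+1.*2 - i.+1 + weight u))%N.
  by rewrite /weight !big_cons.
have swt' : square_weight t' = (i.+1 ^ 2 + ((k.+1.*2 - i.+1) ^ 2 + square_weight u))%N.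
  by rewrite /square_weight !big_cons.
have eq_w : weight t' = weight t by rewrite wt' wt; lia.
have lt_sw : (square_weight t < square_weight t')%N.
  rewrite swt swt' !addnA ltn_add2r.
  exact: sqr_spread.
have le_t' := square_weight_le t'; rewrite eq_w in le_t'.
have := IHd t'; rewrite eq_w /t' !hath_mon_cons mulrA; apply=> //.
by rewrite -/t'; move: (weight t ^ 2)%N le_d le_t' => W; lia.
Qed.

Lemma Zmix_hat_span x : Zmix x -> hat_span x.
Proof.
move=> Zx; have : lin_span *%R Zbar hath_mon x.
  apply: (Zalg_gen_monomials (g := fun k => hath (val k)) _ _ _ _ Zx).
  - exact: Zalg_gen_1.
  - exact: Zalg_genN.
  - exact: Zalg_gen_mul.
  - by move=> y [k [->|->]]; [right; exists k | left; apply: Zbar_barh].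
elim=> [|c t Zc|y z _ span_y _ span_z].
- exact: lin_span0.
- exact: hat_spanZ Zc (hath_mon_span t).
exact: lin_spanD.
Qed.

Local Notation bar_span :=
  (lin_span (fun (n : int) (x : Qh) => x *~ n) (fun=> True) bar_prod).

Local Notation bq_span :=
  (lin_span (fun (n : int) (x : Qh) => x *~ n) (fun=> True) Bqpol).

(** Integers are first taken as elements of [Qh], to fit the multiplicative action of
    [Zalg_gen_monomials], and then turned back into [int] scalars. *)
Lemma Zbar_bar_span x : Zbar x -> bar_span x.
Proof.
move=> Zx; have : lin_span *%R (fun y : Qh => exists n : int, y = n%:~R)
    (fun t : seq posnat => \prod_(k <- t) barh (2 * val k)) x.
  apply: (Zalg_gen_monomials (g := fun k => barh (2 * val k)) _ _ _ _ Zx).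
  - by exists 1.
  - by move=> y [n ->]; exists (- n); rewrite rmorphN.
  - by move=> y z [n ->] [m ->]; exists (n * m); rewrite rmorphM.
  - by move=> y [k ->]; right; exists k.
elim=> [|c t [n ->]|y z _ span_y _ span_z].
- exact: lin_span0.
- have [d ->] := bar_prod_seq t.
  by rewrite mulrzl; apply: (lin_span_gen _ bar_prod).
exact: lin_spanD.
Qed.

Lemma Zmix_bq_span x : Zmix x -> bq_span x.
Proof.
move/Zmix_hat_span; elim=> [|c e /Zbar_bar_span Zc|y z _ span_y _ span_z].
- exact: lin_span0.
- elim: Zc => [|n d _|y z _ span_y _ span_z].
  + by rewrite mul0r; apply: lin_span0.
  + rewrite mulrzAl mulrC -[hat_prod e * bar_prod d]/(Bqpol (e, d)).
    exact: (lin_span_gen _ Bqpol).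
  by rewrite mulrDl; apply: lin_spanD.
exact: lin_spanD.
Qed.

(** * Membership, freeness over [Zbar], and the two bases *)

Lemma Zmix_hat_prod e : Zmix (hat_prod e).
Proof.
apply: Zalg_gen_prod => k; apply: Zalg_genX; apply: Zalg_gen_in.
by exists k; left.
Qed.

Lemma Zbar_bar_prod d : Zbar (bar_prod d).
Proof.
by apply: Zalg_gen_prod => k; apply: Zalg_genX; apply: Zbar_barh.
Qed.

(** Expanding each coefficient in the [bar_prod] turns a relation over [Zbar] into an integral
    relation among the [Bqpol]. *)
Lemma hat_prod_free (c : {fsfun {fsfun posnat -> bool with false} -> Qh with 0}) :
    (forall e, Zbar (c e)) -> \sum_(e <- finsupp c) c e * hat_prod e = 0 ->
  forall e, c e = 0.
Proof.
move=> Zc sum0.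
have [f fP] : exists f : {fsfun posnat -> bool with false}
                  -> {fsfun {fsfun posnat -> nat with 0%N} -> int with 0},
    forall e, e \in finsupp c -> c e = \sum_(d <- finsupp (f e)) bar_prod d *~ f e d.
  apply: (seq_choice [fsfun for fun=> 0] (P := fun e (g : {fsfun _ -> int with 0}) =>
    c e = \sum_(d <- finsupp g) bar_prod d *~ g d)) => e _.
  have [g [_ eq_g]] := lin_span_fsfun Logic.I (fun _ _ _ _ => Logic.I)
    (@mulr0z Qh) (fun n n' v => mulrzDr v n n') (Zbar_bar_span (Zc e)).
  by exists g.
(* A common support for all expansions makes the double sum run over a full rectangle of pairs,
   hence over a list without repetition. *)
pose D := (\bigcup_(e <- finsupp c) finsupp (f e))%fset.
have cE e : e \in finsupp c -> c e = \sum_(d <- D) bar_prod d *~ f e d.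
  move=> ce; rewrite fP //; apply: big_fset_incl => [|d _ /fsfun_dflt ->].
    exact: bigfcup_sup.
  exact: mulr0z.
pose s := [seq (e, d) | e <- finsupp c, d <- D].
have uniq_s : uniq s.
  by apply: allpairs_uniq; rewrite ?fset_uniq // => -[a b] [a' b'] _ _ [-> ->].
have f0 p : p \in s -> f p.1 p.2 = 0.
  move: p; apply: (Bqpol_indep (n := fun p => f p.1 p.2) uniq_s).
  rewrite -[RHS]sum0 big_allpairs_dep /=.
  apply: eq_big_seq => e ce; rewrite cE // mulr_suml; apply: eq_bigr => d _.
  by rewrite mulrzAl mulrC.
move=> e; case: (finsuppP c e) => // ce; rewrite cE // big_seq big1 // => d dD.
by rewrite (f0 (e, d)) ?mulr0z //; apply: allpairs_f.
Qed.

Theorem theorem20 :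
  free_module_basis (fun s x : Qh => s * x) Zbar Zmix hat_prod
  /\ free_module_basis (fun (n : int) (x : Qh) => x *~ n) (fun=> True) Zmix Bqpol.
Proof.
split; split.
- exact: Zalg_gen0.
- exact: Zalg_gen_sub.
- by move=> s x /Zbar_sub_Zmix Zs Zx; apply: Zalg_gen_mul.
- exact: Zmix_hat_prod.
- move=> x /Zmix_hat_span; apply: lin_span_fsfun.
  + exact: Zalg_gen0.
  + exact: Zalg_genD.
  + by move=> v; apply: mul0r.
  by move=> c c' v; apply: mulrDl.
- exact: hat_prod_free.
- exact: Zalg_gen0.
- exact: Zalg_gen_sub.
- by move=> n x _; apply: Zalg_genMz.
- move=> [e d]; apply: Zalg_gen_mul; first exact: Zmix_hat_prod.
  exact/Zbar_sub_Zmix/Zbar_bar_prod.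
- move=> x /Zmix_bq_span; apply: lin_span_fsfun => // n n' v.
  exact: mulrzDr.
move=> c _ sum0 p; case: (finsuppP c p) => // cp.
by apply: Bqpol_indep sum0 _ cp; apply: fset_uniq.
Qed.
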